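(* Let $u\in\mathcal{F}(\mathbb{R})$ and $w\in\mathcal{F}_{\mathrm D}(\mathbb{R})$. Suppose that: (i) $w(w^-(0))=u(u^-(0))$ and $w(w^+(0))=u(u^+(0))$; (ii-1) if $u^-(1)$ is an inner point of $[u]_0$ at which $u$ is not differentiable, then $w'_-(w^-(1))=0$; (ii-2) if $u^+(1)$ is an inner point of $[u]_0$ at which $u$ is not differentiable, then $w'_+(w^+(1))=0$; (iv) for every $x\in(u^-(0),u^+(0))$ at which $u$ is not differentiable: (iv-1) if $u^-(0)<x<u^-(1)$, then $w'_+(w^-(\alpha))=0$, where $\alpha=u(x)$; (iv-2) if $u^+(1)<x<u^+(0)$, then $w'_-(w^+(\beta))=0$, where $\beta=u(x)$; (v-1) if $u^-(0)<x\le u^-(1)$ and $u$ is not left-continuous at $x$, then $w'_+(w^-(\beta))=0$, where $\beta=\lim_{y\to x-}u(y)$; (v-2) if $u^+(1)\le x<u^+(0)$ and $u$ is not right-continuous at $x$, then $w'_-(w^+(\gamma))=0$, where $\gamma=\lim_{y\to x+}u(y)$. Then $w$ is a smoother of $u$, i.e. $u\nabla w\in\mathcal{F}_{\mathrm D}(\mathbb{R})$.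
   Context: A fuzzy number is a map $u:\mathbb{R}\to[0,1]$ such that, writing $[u]_\alpha=\{x:u(x)\ge\alpha\}$ for $\alpha\in(0,1]$ and $[u]_0=\overline{\{x:u(x)>0\}}$, the set $[u]_1$ is nonempty and each $[u]_\alpha=[u^-(\alpha),u^+(\alpha)]$, $\alpha\in[0,1]$, is a compact interval. $\mathcal{F}(\mathbb{R})$ is the set of all fuzzy numbers. $\mathcal{F}_{\mathrm C}(\mathbb{R})$: fuzzy numbers $u$ continuous on $[u]_0$ (i.e. the restriction to $[u]_0$ is continuous). $\mathcal{F}_{\mathrm D}(\mathbb{R})$: those $u\in\mathcal{F}_{\mathrm C}(\mathbb{R})$ differentiable on $(u^-(0),u^+(0))$. The sup-min convolution is $(u\nabla v)(x)=\sup_{y\in\mathbb{R}}\min\{u(y),v(x-y)\}$; it is a fuzzy number with $[u\nabla v]_\alpha=[u]_\alpha+[v]_\alpha$. For $u\in\mathcal{F}(\mathbb{R})$ and $v\in\mathcal{F}_{\mathrm D}(\mathbb{R})$, $v$ is a smoother of $u$ if $u\nabla v\in\mathcal{F}_{\mathrm D}(\mathbb{R})$. $f'_-,f'_+$ denote left and right derivatives. An inner point of $[u]_0$ is a point of $(u^-(0),u^+(0))$. *)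

(* Defs.v *)
From HB Require Import structures.
From mathcomp Require Import all_boot all_order all_algebra.
From mathcomp Require Import all_classical all_reals all_analysis.
Set Implicit Arguments.
Unset Strict Implicit.
Unset Printing Implicit Defensive.
Import Order.TTheory GRing.Theory Num.Theory.
Import numFieldNormedType.Exports.
Local Open Scope classical_set_scope.
Local Open Scope ring_scope.

(* [u]_a; only used for a in [0, 1] *)
Definition level_set {R : realType} (u : R -> R) (a : R) : set R :=
  if a == 0 then closure [set x | 0 < u x] else [set x | a <= u x].

Definition fuzzy_number {R : realType} (u : R -> R) : Prop :=
  [/\ forall x, 0 <= u x <= 1,
      level_set u 1 !=set0 &
      forall a, 0 <= a <= 1 ->
        exists l r : R, l <= r /\ level_set u a = `[l, r]%classic].

(* u^-(a) and u^+(a), the endpoints of [u]_a *)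
Definition lower_end {R : realType} (u : R -> R) (a : R) : R :=
  inf (level_set u a).

Definition upper_end {R : realType} (u : R -> R) (a : R) : R :=
  sup (level_set u a).

(* u is in F_C: the restriction of u to [u]_0 is continuous (u may jump at the
   endpoints of [u]_0 as a function on the whole line) *)
Definition fuzzy_continuous {R : realType} (u : R -> R) : Prop :=
  fuzzy_number u /\ {within level_set u 0, continuous u}.

(* u is in F_D *)
Definition fuzzy_differentiable {R : realType} (u : R -> R) : Prop :=
  fuzzy_continuous u /\
  forall x, lower_end u 0 < x < upper_end u 0 -> derivable u x 1.

Definition supmin_conv {R : realType} (u v : R -> R) (x : R) : R :=
  sup [set Num.min (u y) (v (x - y)) | y in [set: R]].

(* for a fuzzy number u and v in F_D *)
Definition smoother {R : realType} (v u : R -> R) : Prop :=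
  fuzzy_differentiable (supmin_conv u v).

(* The one-sided derivative of f at x exists and equals l. Stated as a
   relation because [lim] of a divergent filter is the default value 0. *)
Definition is_left_derive {R : realType} (f : R -> R) (x l : R) : Prop :=
  h^-1 * (f (x + h) - f x) @[h --> 0^'-] --> l.

Definition is_right_derive {R : realType} (f : R -> R) (x l : R) : Prop :=
  h^-1 * (f (x + h) - f x) @[h --> 0^'+] --> l.

(* Main.v *)
Require Import Defs.
From HB Require Import structures.
From mathcomp Require Import all_boot all_order all_algebra.
From mathcomp Require Import all_classical all_reals all_analysis.
From mathcomp Require Import ring lra.
Set Implicit Arguments.
Unset Strict Implicit.
Unset Printing Implicit Defensive.
Import Order.TTheory GRing.Theory Num.Theory.
Import numFieldNormedType.Exports.
Local Open Scope classical_set_scope.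
Local Open Scope ring_scope.

(* Put z = supmin_conv u w.  Everything rests on a pinching principle: if y and
   s lie on the increasing branches of u and w, then
     min (u y, w s) <= z (y + s) <= max (u y, w s),
   because y' + s' = y + s forces y' <= y or s' <= s.  Decompose a point x of
   the left branch as x = y + s with u y >= z x = w s and u <= z x on the left
   of y.
   - If s > w^-(0) and w'(s) = 0, shifting s alone pinches z, so z'(x) = 0.
   - If s > w^-(0) and b = w'(s) > 0, then s = w^-(z x), and by (iv-1) and (v-1)
     either u jumps over the value z x at y, and z is locally the translate
     w (. - y), or u is differentiable at y, with derivative c say; shifting y
     and s in the ratio b : c then pinches z between two functions of equal
     slope b c / (b + c).
   - If s = w^-(0), then z is constant on the left of x, and (iv-1), (v-1) or
     u'(y) = 0 gives z'_+(x) = 0.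
   The right branch follows by the reflection x |-> - x. *)

(** * Difference quotients *)

(** Multiplication by [h^-1] keeps or reverses the order according to the sign of [h]; in both cases
    the quotient of [f] stays between those of [g] and [k]. The filter is arbitrary so that one
    pinching argument covers left, right and two-sided derivatives. *)
Lemma slope_between (R : realType) (F : set_system R) {FF : Filter F}
    (f g k : R -> R) (a l : R) :
  (\forall h \near F,
     Num.min (g h) (k h) <= f h <= Num.max (g h) (k h)) ->
  h^-1 * (g h - a) @[h --> F] --> l ->
  h^-1 * (k h - a) @[h --> F] --> l ->
  h^-1 * (f h - a) @[h --> F] --> l.
Proof.
move=> fgk /cvgrPdist_lt gl /cvgrPdist_lt kl; apply/cvgrPdist_lt => e e0.
move: (gl _ e0) (kl _ e0) fgk; apply: filterS3 => h {gl kl}.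
rewrite !ltr_distlC => /andP[g1 g2] /andP[k1 k2].
wlog gk : g k g1 g2 k1 k2 / g h <= k h => [H|].
  case: (leP (g h) (k h)) => [|/ltW] kg fgk.
    by apply: (H g k) => //; rewrite min_l ?max_r.
  by apply: (H k g) => //; rewrite min_l ?max_r.
rewrite min_l// max_r// => /andP[gf fk].
have [h0|h0] := leP 0 (h^-1).
  have /(ler_wpM2l h0) : g h - a <= f h - a by rewrite lerD2r.
  have /(ler_wpM2l h0) : f h - a <= k h - a by rewrite lerD2r.
  by move=> u1 u2; apply/andP; split;
    [apply: lt_le_trans u2 | apply: le_lt_trans u1 _].
have /(ler_wnM2l (ltW h0)) : g h - a <= f h - a by rewrite lerD2r.
have /(ler_wnM2l (ltW h0)) : f h - a <= k h - a by rewrite lerD2r.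
by move=> u1 u2; apply/andP; split;
  [apply: lt_le_trans u1 | apply: le_lt_trans u2 _].
Qed.

Lemma slope_cst (R : realType) (F : set_system R) {FF : Filter F}
    (f : R -> R) (a : R) :
  (\forall h \near F, f h = a) -> h^-1 * (f h - a) @[h --> F] --> 0.
Proof.
move=> fa; apply/cvgrPdist_lt => e e0; apply: filterS fa => h ->.
by rewrite subrr mulr0 subrr normr0.
Qed.

Lemma slope_between_cst (R : realType) (F : set_system R) {FF : Filter F}
    (f g : R -> R) (a : R) :
  (\forall h \near F, Num.min a (g h) <= f h <= Num.max a (g h)) ->
  h^-1 * (g h - a) @[h --> F] --> 0 ->
  h^-1 * (f h - a) @[h --> F] --> 0.
Proof.
move=> fg g0; apply: (@slope_between R F FF f (cst a) g) => //.
by apply: slope_cst; exact: nearW.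
Qed.

Lemma derivable_slopeP (R : realType) (f : R -> R) (x : R) :
  derivable f x 1 <->
  exists l : R, h^-1 * (f (x + h) - f x) @[h --> 0^'] --> l.
Proof.
have E : (fun h : R => h^-1 *: ((f \o shift x) (h *: 1) - f x)) =
         (fun h => h^-1 * (f (x + h) - f x)).
  by apply/funext => h; rewrite /= [h *: 1]mulr1 [h + x]addrC.
by rewrite /derivable E; split=> [/cvg_ex|[l]]; last exact: cvgP.
Qed.

Lemma derivable_onesided (R : realType) (f : R -> R) (x l : R) :
  is_left_derive f x l -> is_right_derive f x l -> derivable f x 1.
Proof.
move=> fl fr; apply/derivable_slopeP; exists l.
move=> A lA; rewrite /nbhs/= /dnbhs /within/=.
move: (fl _ lA) (fr _ lA); rewrite /nbhs/= /at_left /at_right /within/=.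
by apply: filterS2 => h hl hr; rewrite neq_lt => /orP[/hl|/hr].
Qed.

Lemma slope_left (R : realType) (f : R -> R) (x l : R) :
  h^-1 * (f (x + h) - f x) @[h --> 0^'] --> l -> is_left_derive f x l.
Proof. exact: cvg_dnbhs_at_left. Qed.

Lemma slope_right (R : realType) (f : R -> R) (x l : R) :
  h^-1 * (f (x + h) - f x) @[h --> 0^'] --> l -> is_right_derive f x l.
Proof. exact: cvg_dnbhs_at_right. Qed.

Lemma slope_is_derive (R : realType) (f : R -> R) (x l : R) :
  h^-1 * (f (x + h) - f x) @[h --> 0^'] --> l <-> is_derive x 1 f l.
Proof.
have E : (fun h : R => h^-1 *: ((f \o shift x) (h *: 1) - f x)) =
         (fun h => h^-1 * (f (x + h) - f x)).
  by apply/funext => h; rewrite /= [h *: 1]mulr1 [h + x]addrC.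
split=> [fl|[df <-]].
  split; first by apply/derivable_slopeP; exists l.
  by rewrite /derive E; exact/cvg_lim.
by move: df; rewrite /derivable /derive E.
Qed.

(** Passing through the chain rule covers [k = 0] too, where [h |-> k * h] does not preserve the
    punctured neighbourhood of 0. *)
Lemma slope_scale (R : realType) (f : R -> R) (x k l : R) :
  h^-1 * (f (x + h) - f x) @[h --> 0^'] --> l ->
  h^-1 * (f (x + k * h) - f x) @[h --> 0^'] --> k * l.
Proof.
move=> /slope_is_derive fl.
have : is_derive (0 : R) 1 (f \o (fun h => x + k * h)) (l * k).
  apply: is_derive1_comp; first by rewrite mulr0 addr0.
  by apply: is_derive_eq; rewrite add0r mul1r [_ *: _]mulr1.
move=> /slope_is_derive; rewrite mulrC.
by under eq_fun do rewrite /= add0r mulr0 addr0.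
Qed.

Lemma near0_affine_lt (R : realType) (y k m : R) : y < m ->
  \forall h \near 0, y + k * h < m.
Proof.
move=> ym; have : y + k * h @[h --> 0] --> y + k * 0.
  by apply: cvgD; [exact: cvg_cst|apply: cvgM => //; exact: cvg_cst].
by rewrite mulr0 addr0 => /cvgr_lt; exact.
Qed.

Lemma near0_shift_lt (R : realType) (y m : R) : y < m ->
  \forall h \near 0, y + h < m.
Proof.
move=> /(@near0_affine_lt _ _ 1).
by apply: filterS => h; rewrite mul1r.
Qed.

Lemma near0_shift_gt (R : realType) (y m : R) : m < y ->
  \forall h \near 0, m < y + h.
Proof.
rewrite -ltrN2 => /(@near0_affine_lt _ _ (-1)).
by apply: filterS => h; rewrite mulN1r -opprD ltrN2.
Qed.

(** At a maximum the right quotients are nonpositive and the left ones nonnegative, while both tend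
    to the same limit. *)
Lemma derive_at_max (R : realType) (f : R -> R) (x : R) :
  derivable f x 1 -> (forall y, f y <= f x) ->
  h^-1 * (f (x + h) - f x) @[h --> 0^'] --> 0.
Proof.
move=> /derivable_slopeP[l fl] fx; suff l0 : l = 0 by rewrite l0 in fl.
apply/eqP; rewrite eq_le; apply/andP; split.
  apply: (cvgr_to_le (slope_right fl)); near=> h.
  have h0 : 0 < h by [].
  by apply: mulr_ge0_le0; rewrite ?subr_le0 ?fx// invr_ge0 ltW.
apply: (cvgr_to_ge (slope_left fl)); near=> h.
have h0 : h < 0 by [].
by apply: mulr_le0; rewrite ?subr_le0 ?fx// invr_le0 ltW.
Unshelve. all: by end_near. Qed.

Lemma slope_ge0_homo (R : realType) (f : R -> R) (x m l : R) : x < m ->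
  (forall y, x <= y -> y <= m -> f x <= f y) ->
  h^-1 * (f (x + h) - f x) @[h --> 0^'] --> l -> 0 <= l.
Proof.
move=> xm fx fl; apply: (cvgr_to_ge (slope_right fl)); near=> h.
have h0 : 0 < h by [].
have xh : x + h < m.
  by near: h; apply: cvg_within; exact: near0_shift_lt.
by apply: mulr_ge0; rewrite ?subr_ge0 ?invr_ge0 ?fx//; lra.
Unshelve. all: by end_near. Qed.

(** The two-sided limit exists, so the left quotients alone determine it, and they vanish near 0. *)
Lemma slope_eq0_left_cst (R : realType) (f : R -> R) (x m l : R) : m < x ->
  (forall y, m <= y -> y <= x -> f y = f x) ->
  h^-1 * (f (x + h) - f x) @[h --> 0^'] --> l -> l = 0.
Proof.
move=> mx fx /slope_left fl; apply: (cvg_unique _ fl) => //.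
apply: slope_cst; near=> h; apply: fx.
  by apply: ltW; near: h; apply: cvg_within; exact: near0_shift_gt.
have h0 : h < 0 by []; lra.
Unshelve. all: by end_near. Qed.

(** * Fuzzy numbers and their sup-min convolution *)

Section FuzzyNumber.
Variables (R : realType) (u : R -> R).
Hypothesis fu : fuzzy_number u.

Lemma fuzzy_ge0 x : 0 <= u x.
Proof. by case: fu => /(_ x)/andP[]. Qed.

Lemma fuzzy_le1 x : u x <= 1.
Proof. by case: fu => /(_ x)/andP[]. Qed.

Lemma level_setE a : 0 <= a <= 1 ->
  level_set u a = `[lower_end u a, upper_end u a]%classic.
Proof.
case: fu => _ _ /[apply] -[l [r [lr E]]].
by rewrite /lower_end /upper_end E inf_itvcc// sup_itvcc.
Qed.

Lemma lower_le_upper a : 0 <= a <= 1 -> lower_end u a <= upper_end u a.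
Proof.
case: fu => _ _ /[apply] -[l [r [lr E]]].
by rewrite /lower_end /upper_end E inf_itvcc// sup_itvcc.
Qed.

Lemma level_setP a x : 0 < a <= 1 ->
  (a <= u x) = (lower_end u a <= x <= upper_end u a).
Proof.
move=> /andP[a0 a1].
have := @level_setE a; rewrite (ltW a0) a1 => /(_ isT).
rewrite /level_set gt_eqF// => /seteqP[E1 E2].
by apply/idP/idP => [/E1|H]; [rewrite /= in_itv | apply: E2; rewrite /= in_itv].
Qed.

Lemma support_bounds x : 0 < u x -> lower_end u 0 <= x <= upper_end u 0.
Proof.
move=> ux; suff : level_set u 0 x.
  by rewrite level_setE ?lexx ?ler01//= in_itv.
by rewrite /level_set eqxx; exact: subset_closure.
Qed.

Lemma fuzzy_eq0_below x : x < lower_end u 0 -> u x = 0.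
Proof.
move=> xl; apply/eqP; rewrite eq_le fuzzy_ge0 andbT leNgt; apply/negP.
by move=> /support_bounds/andP[/(lt_le_trans xl)]; rewrite ltxx.
Qed.

Lemma fuzzy_lower_ge a : 0 <= a <= 1 -> a <= u (lower_end u a) \/ a = 0.
Proof.
move=> /andP[a0 a1]; case: (ltgtP 0 a) a0 => // [a0 _|]; last by right.
by left; rewrite level_setP ?a0// lexx lower_le_upper// (ltW a0).
Qed.

Lemma core_ends : lower_end u 1 <= upper_end u 1.
Proof. by rewrite lower_le_upper// ler01 lexx. Qed.

Lemma fuzzy_core x : lower_end u 1 <= x <= upper_end u 1 -> u x = 1.
Proof.
by move=> x1; apply/eqP; rewrite eq_le fuzzy_le1/= level_setP// ltr01 lexx.
Qed.

Lemma fuzzy_lower1 : u (lower_end u 1) = 1.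
Proof. by rewrite fuzzy_core// lexx core_ends. Qed.

(** The level set at height [u x] is an interval containing both [x] and u^-(1), hence also [y].
    Height 0 is treated apart because that level is a closure. *)
Lemma fuzzy_nondecr x y : x <= y -> y <= lower_end u 1 -> u x <= u y.
Proof.
move=> xy y1; have [ux|] := ltP 0 (u x); last first.
  by move=> ux; exact: le_trans ux (fuzzy_ge0 _).
have ux1 : 0 < u x <= 1 by rewrite ux fuzzy_le1.
rewrite level_setP//.
have /andP[l r] : lower_end u (u x) <= x <= upper_end u (u x).
  by rewrite -level_setP.
have /andP[l1 r1] : lower_end u (u x) <= lower_end u 1 <= upper_end u (u x).
  by rewrite -level_setP// fuzzy_lower1 fuzzy_le1.
by rewrite (le_trans l xy) (le_trans y1 r1).
Qed.

Lemma lower_end0_le a : 0 <= a <= 1 -> lower_end u 0 <= lower_end u a.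
Proof.
move=> a01; case: (fuzzy_lower_ge a01) => [|-> //].
case/andP: a01; rewrite le_eqVlt => /orP[/eqP <- //|a0 _] /(lt_le_trans a0).
by case/support_bounds/andP.
Qed.

Lemma lower_end_le1 a : 0 <= a <= 1 -> lower_end u a <= lower_end u 1.
Proof.
move=> /andP[a0 a1].
have h1 := core_ends.
case: (ltgtP 0 a) a0 => // [a0 _|<- _].
  suff /andP[] : lower_end u a <= lower_end u 1 <= upper_end u a by [].
  by rewrite -level_setP ?a0// fuzzy_lower1.
by rewrite lower_end0_le// ler01 lexx.
Qed.

Lemma upper_end1_le : upper_end u 1 <= upper_end u 0.
Proof.
have h1 := core_ends.
suff /support_bounds/andP[] : 0 < u (upper_end u 1) by [].
by rewrite fuzzy_core// lexx h1.
Qed.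

(** Through this identity, condition (i) makes the levels of [u] and [w] at the common base value
    start at the ends of their supports. *)
Lemma lower_end_base : lower_end u (u (lower_end u 0)) = lower_end u 0.
Proof.
have [a0|] := ltP 0 (u (lower_end u 0)); last first.
  move=> a0; congr lower_end; apply/eqP; by rewrite eq_le a0 fuzzy_ge0.
have a01 : 0 < u (lower_end u 0) <= 1 by rewrite a0 fuzzy_le1.
apply/eqP; rewrite eq_le lower_end0_le ?fuzzy_ge0 ?fuzzy_le1// andbT.
by have := lexx (u (lower_end u 0)); rewrite level_setP// => /andP[].
Qed.

(** By monotonicity the left limit is the supremum of the values on the left; it provides the limit
    that (v-1) speaks of. *)
Lemma fuzzy_left_limit x : x <= lower_end u 1 ->
  exists2 b, u @ x^'- --> b & forall y, y < x -> u y <= b.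
Proof.
move=> x1; pose S := [set u y | y in [set y | y < x]].
have ubS : has_ubound S by exists 1 => _ [y _ <-]; exact: fuzzy_le1.
have S0 : S !=set0 by exists (u (x - 1)); exists (x - 1) => //=; lra.
exists (sup S); last by move=> y yx; apply: ub_le_sup => //; exists y.
apply/cvgrPdist_lt => e e0.
have [_ [y /= yx <-] ye] := @sup_adherent _ S _ e0 (conj S0 ubS).
near=> t; have tx : t < x by near: t; exact: nbhs_left_lt.
have ty : y <= t by near: t; apply: nbhs_left_ge.
have ut : u t <= sup S by apply: ub_le_sup => //; exists t.
have uyt : u y <= u t by apply: fuzzy_nondecr => //; lra.
by rewrite ltr_distl; apply/andP; split; lra.
Unshelve. all: by end_near. Qed.

End FuzzyNumber.

Section Convolution.
Variables (R : realType) (u w : R -> R).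
Hypotheses (fu : fuzzy_number u) (fw : fuzzy_number w).
Local Notation z := (supmin_conv u w).

Lemma supmin_has_sup x :
  has_sup [set Num.min (u y) (w (x - y)) | y in [set: R]].
Proof.
split; first by exists (Num.min (u 0) (w (x - 0))); exists 0.
by exists 1 => _ [y _ <-]; rewrite ge_min fuzzy_le1.
Qed.

Lemma supmin_ge_min y s : Num.min (u y) (w s) <= z (y + s).
Proof.
apply: ub_le_sup; first exact: (supmin_has_sup _).2.
by exists y => //; rewrite [y + s]addrC addrK.
Qed.

(** Any other decomposition of [y + s] has its first term below [y] or its second at most [s]. The
    bound on [u] is asked strictly left of [y] only, since [u] may jump above [c] at [y]. *)
Lemma supmin_le y s c : (forall y', y' < y -> u y' <= c) ->
  (forall s', s' <= s -> w s' <= c) -> z (y + s) <= c.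
Proof.
move=> uc wc; apply: ge_sup; first exact: (supmin_has_sup _).1.
move=> _ [t _ <-]; rewrite ge_min; have [ty|yt] := ltP t y.
  by rewrite uc.
by rewrite [X in _ || X]wc ?orbT//; lra.
Qed.

Lemma supmin_ge0 x : 0 <= z x.
Proof.
rewrite -(subrK 0 x); apply: le_trans (supmin_ge_min _ _).
by rewrite le_min !fuzzy_ge0.
Qed.

Lemma supmin_le1 x : z x <= 1.
Proof.
rewrite -(subrK 0 x).
by apply: supmin_le => *; exact: fuzzy_le1.
Qed.

Lemma supmin_gt c x : c < z x -> exists y s, [/\ x = y + s, c < u y & c < w s].
Proof.
move=> cz; have [_ [y _ <-]] := sup_gt (supmin_has_sup x).1 cz.
rewrite lt_min => /andP[cu cw]; exists y, (x - y); split=> //.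
by rewrite addrC subrK.
Qed.

Lemma supmin_le_max y s : y <= lower_end u 1 -> s <= lower_end w 1 ->
  z (y + s) <= Num.max (u y) (w s).
Proof.
move=> yu sw; apply: supmin_le => [t ty|t ts]; rewrite le_max.
  by rewrite fuzzy_nondecr// ltW.
by rewrite [X in _ || X]fuzzy_nondecr ?orbT.
Qed.

End Convolution.

(** * Reflection *)

Section Reflection.
Variable R : realType.
Implicit Types (f u w : R -> R) (A : set R).

Lemma closure_opp A x : closure A (- x) -> closure [set y | A (- y)] x.
Proof.
move=> cA B /nbhs_ballP[e /= e0 eB].
have [y [Ay]] := cA _ (nbhsx_ballx (- x) e e0).
rewrite /ball/= => ye; exists (- y); split; first by rewrite /= opprK.
by apply: eB; rewrite /ball/= opprK -normrN opprD.
Qed.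

Lemma opp_funK f : (f \o -%R) \o -%R = f.
Proof. by apply/funext => x; rewrite /= opprK. Qed.

Lemma level_set_opp u a :
  level_set (u \o -%R) a = [set x | level_set u a (- x)].
Proof.
rewrite /level_set; case: eqP => // _; apply/seteqP; split=> x /=.
  rewrite -{1}(opprK x) => /closure_opp.
  by congr (closure _ _); apply/funext => y; rewrite /= opprK.
exact: closure_opp.
Qed.

Lemma lower_end_opp u a : lower_end (u \o -%R) a = - upper_end u a.
Proof.
rewrite /lower_end /upper_end /inf level_set_opp; congr (- sup _).
apply/seteqP; split=> [_ [x /= ux <-] //|x ux].
by exists (- x); rewrite /= opprK.
Qed.

Lemma upper_end_opp u a : upper_end (u \o -%R) a = - lower_end u a.
Proof. by rewrite -[in RHS](opp_funK u) lower_end_opp opprK. Qed.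

Lemma fuzzy_number_opp u : fuzzy_number u -> fuzzy_number (u \o -%R).
Proof.
move=> [u01 [c uc] ua]; split=> [x||a /ua[l [r [lr E]]]].
- exact: u01.
- by exists (- c); rewrite level_set_opp /= opprK.
- exists (- r), (- l); split; first by rewrite lerN2.
  rewrite level_set_opp E; apply/seteqP; split=> x /=; rewrite !in_itv/=; lra.
Qed.

Lemma supmin_opp u w :
  supmin_conv (u \o -%R) (w \o -%R) = supmin_conv u w \o -%R.
Proof.
apply/funext => x; rewrite /supmin_conv /=; congr sup.
apply/seteqP; split=> _ [y _ <-]; exists (- y) => //=.
  by rewrite opprD.
by rewrite !opprK opprD.
Qed.

Lemma cvg_opp_at_left (T : topologicalType) (f : R -> T) (x : R)
    (F : set_system T) :
  f \o -%R @ x^'- --> F <-> f @ (- x)^'+ --> F.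
Proof. by rewrite at_rightN. Qed.

Lemma cvg_opp_at_right (T : topologicalType) (f : R -> T) (x : R)
    (F : set_system T) :
  f \o -%R @ x^'+ --> F <-> f @ (- x)^'- --> F.
Proof. by rewrite at_leftN. Qed.

Lemma left_derive_comp_opp f x l :
  is_left_derive (f \o -%R) x l <-> is_right_derive f (- x) (- l).
Proof.
rewrite /is_left_derive /is_right_derive -[X in X^'+]oppr0 at_rightN.
rewrite -[in X in _ <-> X]fmap_comp.
set g := (fun h => h^-1 * ((f \o -%R) (x + h) - (f \o -%R) x)).
have -> : (fun h => h^-1 * (f (- x + h) - f (- x))) \o -%R = - g.
  by apply/funext => h; rewrite /= invrN mulNr -opprD.
split; first exact: cvgN.
by move=> /cvgN; rewrite !opprK.
Qed.

Lemma right_derive_comp_opp f x l :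
  is_right_derive (f \o -%R) x l <-> is_left_derive f (- x) (- l).
Proof.
by rewrite -[X in is_left_derive X _ _]opp_funK left_derive_comp_opp !opprK.
Qed.

Lemma derivable_comp_opp f x : derivable (f \o -%R) x 1 <-> derivable f (- x) 1.
Proof.
wlog suff : f x / derivable f (- x) 1 -> derivable (f \o -%R) x 1 => [H|].
  split; last exact: H.
  by move=> df; rewrite -(opp_funK f); apply: H; rewrite opprK.
move=> /derivable_slopeP[l fl]; apply: (@derivable_onesided _ _ _ (- l)).
  by apply/left_derive_comp_opp; rewrite opprK; exact: slope_right.
by apply/right_derive_comp_opp; rewrite opprK; exact: slope_left.
Qed.

End Reflection.

(** * Level sets of the convolution *)

Lemma supmin_level_lower (R : realType) (u w : R -> R) (a x : R) :
  fuzzy_number u -> fuzzy_number w -> 0 < a <= 1 -> a <= supmin_conv u w x ->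
  lower_end u a + lower_end w a <= x.
Proof.
move=> fu fw a01 az; rewrite leNgt; apply/negP => xl.
have /andP[a0 a1] := a01; have a01' : 0 <= a <= 1 by rewrite ltW.
have ltl (v : R -> R) t : fuzzy_number v -> t < lower_end v a -> v t < a.
  by move=> fv tv; rewrite ltNge level_setP// negb_and -ltNge tv.
have lu1 := lower_end_le1 fu a01'; have lw1 := lower_end_le1 fw a01'.
(* Half of the deficit goes to each summand, so that both points fall strictly below the ends of
   their levels and both values are below [a]. *)
pose d := (lower_end u a + lower_end w a - x) / 2.
have xE : x = (lower_end u a - d) + (lower_end w a - d) by rewrite /d; lra.
move: az; rewrite leNgt xE => /negP; apply.
apply: (@le_lt_trans _ _
  (Num.max (u (lower_end u a - d)) (w (lower_end w a - d)))).
  by apply: supmin_le_max => //; rewrite /d; lra.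
by rewrite gt_max !ltl//; rewrite /d; lra.
Qed.

Lemma supmin_support_lower (R : realType) (u w : R -> R) (x : R) :
  fuzzy_number u -> fuzzy_number w -> 0 < supmin_conv u w x ->
  lower_end u 0 + lower_end w 0 <= x.
Proof.
move=> fu fw /(supmin_gt fu)[y [s [-> uy ws]]].
have /andP[yl _] := support_bounds fu uy.
have /andP[sl _] := support_bounds fw ws.
by rewrite lerD.
Qed.

Section ConvolutionLevels.
Variables (R : realType) (u w : R -> R).
Hypotheses (fu : fuzzy_number u) (fw : fuzzy_number w).
Local Notation z := (supmin_conv u w).

Lemma supmin_level_upper a x : 0 < a <= 1 -> a <= z x ->
  x <= upper_end u a + upper_end w a.
Proof.
move=> a01 az; have := @supmin_level_lower R (u \o -%R) (w \o -%R) a (- x).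
rewrite supmin_opp !lower_end_opp /= opprK -opprD lerN2; apply=> //;
exact: fuzzy_number_opp.
Qed.

Lemma supmin_support_upper x : 0 < z x -> x <= upper_end u 0 + upper_end w 0.
Proof.
move=> az; have := @supmin_support_lower R (u \o -%R) (w \o -%R) (- x).
rewrite supmin_opp !lower_end_opp /= opprK -opprD lerN2; apply=> //;
exact: fuzzy_number_opp.
Qed.

(** The second summand stays at [c] as long as the first fits below [b]; beyond that the first one
    is fixed at [b]. *)
Lemma itv_sum (a b c d x : R) : a <= b -> c <= d -> a + c <= x <= b + d ->
  exists y s, [/\ x = y + s, a <= y <= b & c <= s <= d].
Proof.
move=> ab cd /andP[x1 x2]; have [xbc|bcx] := leP (x - c) b.
  by exists (x - c), c; split; lra.
by exists b, (x - b); split; lra.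
Qed.

Lemma supmin_level_set a : 0 <= a <= 1 -> level_set z a =
  `[lower_end u a + lower_end w a, upper_end u a + upper_end w a]%classic.
Proof.
move=> a01; have lu := lower_le_upper fu a01; have lw := lower_le_upper fw a01.
move: (a01) => /andP[]; rewrite le_eqVlt => /orP[/eqP a0 _|a0 a1]; last first.
  have a01' : 0 < a <= 1 by rewrite a0.
  rewrite /level_set gt_eqF//; apply/seteqP; split=> x /=; rewrite in_itv/=.
    by move=> az; rewrite supmin_level_lower//= supmin_level_upper.
  move=> /(itv_sum lu lw)[y [s [-> yu sw]]].
  apply: le_trans (supmin_ge_min _ fu _ _).
  by rewrite le_min (level_setP fu)// (level_setP fw)// yu sw.
rewrite -{}a0 in a01 lu lw *; rewrite /level_set eqxx.
apply/seteqP; split=> x.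
  rewrite [X in _ -> X x]((closure_id _).1 (@itv_closed _ _ _ _)).
  apply: closure_subset => {}x /= zx; rewrite in_itv/=.
  by rewrite supmin_support_lower// supmin_support_upper.
rewrite /= in_itv/= => /(itv_sum lu lw)[y [s [-> yu sw]]] B.
(* Level 0 is a closure: [y] and [s] are approximated within [e / 2] by points of positive value,
   whose sum has positive value and is within [e] of [y + s]. *)
move=> /nbhs_ballP[e /= e0 eB]; have e20 : 0 < e / 2 by rewrite divr_gt0.
have : level_set u 0 y by rewrite level_setE//= in_itv.
rewrite /level_set eqxx => /(_ _ (nbhsx_ballx y _ e20))[y' [/= uy' yy']].
have : level_set w 0 s by rewrite level_setE//= in_itv.
rewrite /level_set eqxx => /(_ _ (nbhsx_ballx s _ e20))[s' [/= ws' ss']].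
exists (y' + s'); split.
  by apply: lt_le_trans (supmin_ge_min _ fu _ _); rewrite lt_min uy' ws'.
apply: eB; move: yy' ss'; rewrite /ball/= !ltr_distl; lra.
Qed.

Lemma supmin_fuzzy : fuzzy_number z.
Proof.
split=> [x||a a01]; first by rewrite supmin_ge0// supmin_le1.
  exists (lower_end u 1 + lower_end w 1).
  by rewrite supmin_level_set ?ler01 ?lexx//= in_itv/= lexx lerD ?core_ends.
do 2 eexists; split; last exact: supmin_level_set.
by rewrite lerD ?lower_le_upper.
Qed.

Lemma lower_end_supmin a : 0 <= a <= 1 ->
  lower_end z a = lower_end u a + lower_end w a.
Proof.
move=> a01; rewrite [LHS]/lower_end supmin_level_set// inf_itvcc//.
by rewrite lerD ?lower_le_upper.
Qed.

Lemma upper_end_supmin a : 0 <= a <= 1 ->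
  upper_end z a = upper_end u a + upper_end w a.
Proof.
move=> a01; rewrite [LHS]/upper_end supmin_level_set// sup_itvcc//.
by rewrite lerD ?lower_le_upper.
Qed.

End ConvolutionLevels.

(** * The left branch *)

(** The point v^-(0) belongs to the closure of the positivity set, so the neighbourhood []-oo, x[]
    of it contains a point of positive value; monotonicity carries positivity to [x]. *)
Lemma fuzzy_gt0_inner (R : realType) (v : R -> R) (x : R) :
  fuzzy_number v -> lower_end v 0 < x <= lower_end v 1 -> 0 < v x.
Proof.
move=> fv /andP[lx x1]; rewrite ltNge; apply/negP => vx.
have lvl : level_set v 0 (lower_end v 0).
  rewrite level_setE ?lexx ?ler01//= in_itv/= lexx.
  by rewrite lower_le_upper ?lexx ?ler01.
move: lvl; rewrite /level_set eqxx => /(_ `]-oo, x[%classic).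
case; first exact: lt_nbhsl.
move=> y [/= vy]; rewrite in_itv/= => yx.
have := lt_le_trans vy (le_trans (fuzzy_nondecr fv (ltW yx) x1) vx).
by rewrite ltxx.
Qed.

Lemma fuzzy_lt1 (R : realType) (v : R -> R) (x : R) :
  fuzzy_number v -> x < lower_end v 1 -> v x < 1.
Proof.
by move=> fv x1; rewrite ltNge level_setP ?ltr01 ?lexx// negb_and -ltNge x1.
Qed.

Section OneSidedContinuity.
Variables (R : realType) (w : R -> R).
Hypothesis hw : fuzzy_differentiable w.

Lemma fuzzy_inner_cvg x : lower_end w 0 < x < upper_end w 0 -> w @ x --> w x.
Proof. by move=> /hw.2/derivable1_diffP/differentiable_continuous. Qed.

Lemma fuzzy_ends_cvg : lower_end w 0 < upper_end w 0 ->
  w @ (lower_end w 0)^'+ --> w (lower_end w 0) /\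
  w @ (upper_end w 0)^'- --> w (upper_end w 0).
Proof.
move=> lu; have [[fw cw] _] := hw.
move: cw; rewrite level_setE ?lexx ?ler01//.
by move=> /(continuous_within_itvP _ lu)[].
Qed.

Lemma fuzzy_left_cvg x : lower_end w 0 < x <= upper_end w 0 -> w @ x^'- --> w x.
Proof.
move=> /andP[lx]; rewrite le_eqVlt => /orP[/eqP xu|xu].
  by rewrite xu in lx *; exact: (fuzzy_ends_cvg lx).2.
by apply: cvg_at_left_filter; apply: fuzzy_inner_cvg; rewrite lx.
Qed.

End OneSidedContinuity.

Lemma cvg_right_shiftP (R : realType) (f : R -> R) (x l : R) :
  f @ x^'+ --> l <-> f (x + h) @[h --> 0^'+] --> l.
Proof.
split=> fl P /fl H; first exact: (nbhs_right0P x (f @^-1` P)).1.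
exact: (nbhs_right0P x (f @^-1` P)).2.
Qed.

Section LeftBranch.
Variables (R : realType) (u w : R -> R).
(** Besides (i), only the left halves (ii-1), (iv-1) and (v-1) of the conditions are assumed, so
    that the section also applies to the reflected pair, for which the right halves become left
    ones. *)
Hypotheses (fu : fuzzy_number u) (hw : fuzzy_differentiable w).
Hypothesis base0 : w (lower_end w 0) = u (lower_end u 0).
Hypothesis base1 : w (upper_end w 0) = u (upper_end u 0).
Hypothesis kink_core : lower_end u 0 < lower_end u 1 < upper_end u 0 ->
  ~ derivable u (lower_end u 1) 1 -> is_left_derive w (lower_end w 1) 0.
Hypothesis kink_slope : forall x, lower_end u 0 < x < lower_end u 1 ->
  ~ derivable u x 1 -> is_right_derive w (lower_end w (u x)) 0.
Hypothesis jump : forall x b, lower_end u 0 < x <= lower_end u 1 ->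
  ~ (u @ x^'- --> u x) -> u @ x^'- --> b ->
  is_right_derive w (lower_end w b) 0.
Local Notation z := (supmin_conv u w).
(** In terms of z these three points are z^-(0), z^-(1) and z^+(0). *)
Local Notation A := (lower_end u 0 + lower_end w 0).
Local Notation C := (lower_end u 1 + lower_end w 1).
Local Notation B := (upper_end u 0 + upper_end w 0).

Let fw : fuzzy_number w. Proof. by case: hw => -[]. Qed.
Let fz : fuzzy_number z. Proof. exact: supmin_fuzzy. Qed.
Let i01 : 0 <= (0 : R) <= 1. Proof. by rewrite lexx ler01. Qed.
Let i11 : 0 <= (1 : R) <= 1. Proof. by rewrite lexx ler01. Qed.
Let zA : lower_end z 0 = A. Proof. exact: lower_end_supmin. Qed.
Let zC : lower_end z 1 = C. Proof. exact: lower_end_supmin. Qed.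

Let zmono x y : x <= y -> y <= C -> z x <= z y.
Proof. by rewrite -zC; exact: fuzzy_nondecr. Qed.

Lemma supmin_base : z A = u (lower_end u 0).
Proof.
apply/eqP; rewrite eq_le; apply/andP; split.
  apply: supmin_le => // [y|s s0].
    by move/(fuzzy_eq0_below fu) ->; exact: fuzzy_ge0.
  by rewrite -base0 fuzzy_nondecr// lower_end0_le.
by apply: le_trans (supmin_ge_min _ fu _ _); rewrite base0 minxx.
Qed.

Lemma supmin_base_le x : A <= x -> x <= C -> u (lower_end u 0) <= z x.
Proof. by move=> Ax xC; rewrite -supmin_base zmono. Qed.

(** With [a = z x], every point between v^-(a) and the infimum of [v > a] has value at least [a],
    with values at most [a] on its left, for [v] equal to [u] or [w]. It remains to see that [x] is
    a sum of two such points. *)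
Lemma supmin_split x : A < x -> x < C -> exists y s,
  [/\ x = y + s, y <= lower_end u 1 /\ s <= lower_end w 1,
      z x <= u y /\ z x <= w s,
      forall y', y' < y -> u y' <= z x &
      forall s', s' < s -> w s' <= z x].
Proof.
move=> Ax xC; set a := z x.
have a0 : 0 < a by apply: fuzzy_gt0_inner => //; rewrite zA zC Ax ltW.
have a1 : a < 1 by apply: fuzzy_lt1; rewrite ?zC.
have a01 : 0 < a <= 1 by rewrite a0 ltW.
have a01' : 0 <= a <= 1 by rewrite !ltW.
have lb (v : R -> R) : fuzzy_number v ->
    lbound [set y | a < v y] (lower_end v a).
  by move=> fv y /= /ltW; rewrite level_setP// => /andP[].
have one (v : R -> R) : fuzzy_number v -> [set y | a < v y] (lower_end v 1).
  by move=> fv /=; rewrite fuzzy_lower1.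
have hinf (v : R -> R) : fuzzy_number v -> has_inf [set y | a < v y].
  by move=> fv; split; [exists (lower_end v 1); exact: one|
                        exists (lower_end v a); exact: lb].
have le_inf_ (v : R -> R) : fuzzy_number v ->
    lower_end v a <= inf [set y | a < v y].
  by move=> fv; apply: lb_le_inf; [exact: (hinf _ fv).1|exact: lb].
have inf_le1 (v : R -> R) : fuzzy_number v ->
    inf [set y | a < v y] <= lower_end v 1.
  by move=> fv; apply: ge_inf; [exact: (hinf _ fv).2|exact: one].
have below (v : R -> R) t : fuzzy_number v ->
    t < inf [set y | a < v y] -> v t <= a.
  move=> fv tv; rewrite leNgt; apply/negP => av; move: tv.
  by apply/negP; rewrite -leNgt; apply: ge_inf => //; exact: (hinf _ fv).2.
have at_least (v : R -> R) t : fuzzy_number v -> lower_end v a <= t ->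
    t <= inf [set y | a < v y] -> a <= v t.
  move=> fv lt_ ti; case: (fuzzy_lower_ge fv a01') => [|E].
    move=> /le_trans; apply; apply: fuzzy_nondecr => //.
    exact: le_trans ti (inf_le1 _ fv).
  by move: a0; rewrite E ltxx.
have xlow : lower_end u a + lower_end w a <= x by apply: supmin_level_lower.
(* Otherwise, sharing the excess equally yields points with values above [a] and sum at most [x], so
   that monotonicity of z gives [z x > a]. *)
have xhigh : x <= inf [set y | a < u y] + inf [set y | a < w y].
  rewrite leNgt; apply/negP => hx.
  pose d := (x - (inf [set y | a < u y] + inf [set y | a < w y])) / 2.
  have d0 : 0 < d by rewrite /d; lra.
  have [y /= uy yd] := inf_adherent d0 (hinf _ fu).
  have [s /= ws sd] := inf_adherent d0 (hinf _ fw).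
  have ysx : y + s <= x by rewrite /d in yd sd; lra.
  have : z (y + s) <= a by apply: zmono => //; exact: ltW.
  apply/negP; rewrite -ltNge; apply: lt_le_trans (supmin_ge_min _ fu _ _).
  by rewrite lt_min uy ws.
have [|y [s [xE /andP[y1 y2] /andP[s1 s2]]]] :=
    itv_sum (le_inf_ _ fu) (le_inf_ _ fw) (x := x); first by rewrite xlow.
exists y, s; split=> //.
- by split; [exact: le_trans (inf_le1 _ fu)|exact: le_trans (inf_le1 _ fw)].
- by split; exact: at_least.
- by move=> y' yy; apply: below => //; exact: lt_le_trans y2.
- by move=> s' ss; apply: below => //; exact: lt_le_trans s2.
Qed.

(* Moving only the [w]-coordinate of a decomposition [x = y + s] pinches the
   convolution between its value at [x] and the shifted [w]. *)
Lemma supmin_pinch y s t : z (y + s) <= u y ->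
  (forall y', y' < y -> u y' <= z (y + s)) -> t <= lower_end w 1 ->
  Num.min (z (y + s)) (w t) <= z (y + t) <= Num.max (z (y + s)) (w t).
Proof.
move=> zu uz t1; apply/andP; split.
  apply: le_trans (supmin_ge_min _ fu _ _).
  by rewrite le_min ge_min zu/= ge_min lexx orbT.
apply: supmin_le => // [y' yy|t' tt]; rewrite le_max; first by rewrite uz.
by rewrite [X in _ || X]fuzzy_nondecr ?orbT.
Qed.

Lemma supmin_slope_pinch (F : set_system R) {FF : Filter F} y s :
  z (y + s) <= u y -> (forall y', y' < y -> u y' <= z (y + s)) ->
  w s = z (y + s) -> (\forall h \near F, s + h <= lower_end w 1) ->
  h^-1 * (w (s + h) - w s) @[h --> F] --> 0 ->
  h^-1 * (z (y + s + h) - z (y + s)) @[h --> F] --> 0.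
Proof.
move=> zu uz ws s1; rewrite ws; apply: slope_between_cst.
by apply: filterS s1 => h s1; rewrite -addrA; exact: supmin_pinch.
Qed.

Lemma supmin_derivable_left_inner y s : let x := y + s in
  A < x -> x < C -> y <= lower_end u 1 ->
  lower_end w 0 < s -> s < lower_end w 1 -> w s = z x -> z x <= u y ->
  (forall y', y' < y -> u y' <= z x) ->
  derivable z x 1.
Proof.
move=> x Ax xC y1 ls s1 ws zu uz.
have z1 : z x < 1 by apply: fuzzy_lt1; rewrite ?zC.
have z01 : 0 <= z x <= 1 by rewrite (fuzzy_ge0 fz) ltW.
have z0 : 0 < z x by apply: fuzzy_gt0_inner => //; rewrite zA zC Ax ltW.
have wsu : lower_end w 1 <= upper_end w 0.
  exact: le_trans (core_ends fw) (upper_end1_le fw).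
have usu : lower_end u 1 <= upper_end u 0.
  exact: le_trans (core_ends fu) (upper_end1_le fu).
have /derivable_slopeP[b wb] : derivable w s 1.
  by apply: hw.2; rewrite ls (lt_le_trans s1).
apply/derivable_slopeP; have [b0|b0] := eqVneq b 0.
  exists 0; rewrite b0 in wb; apply: supmin_slope_pinch => //.
  apply: nbhs_dnbhs; have := near0_shift_lt s1.
  by apply: filterS => h /ltW.
(* Between w^-(z x) and [s] the function [w] is constant, so a gap there would force [b = 0]. *)
have lws : lower_end w (z x) = s.
  have /andP[ql qu] : lower_end w (z x) <= s <= upper_end w (z x).
    by rewrite -level_setP ?ws// z0 ltW.
  apply/eqP; rewrite eq_le ql /= leNgt; apply/negP => qs.
  move: b0; apply/negP; rewrite negbK; apply/eqP.
  apply: (slope_eq0_left_cst qs _ wb) => t qt ts; apply/eqP; rewrite eq_le.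
  have -> : w t <= w s by apply: fuzzy_nondecr => //; exact: ltW.
  by rewrite ws (level_setP fw) ?qt ?(le_trans ts qu)// z0 ltW.
(* Conditions (iv-1) and (v-1), applied at level [z x], would conclude the contrary; this is how
   their premises get excluded. *)
have noright : ~ is_right_derive w s 0.
  move=> w0; move: b0; apply/negP; rewrite negbK; apply/eqP.
  exact: (cvg_unique _ (slope_right wb) w0).
have a0z : u (lower_end u 0) <= z x by rewrite supmin_base_le ?ltW.
have ly0 : lower_end u 0 <= y.
  by have /andP[] := support_bounds fu (lt_le_trans z0 zu).
(* If [y] were u^-(0), then [z x] would be the base value and [s] would be w^-(0). *)
have ly : lower_end u 0 < y.
  rewrite lt_neqAle ly0 andbT; apply/eqP => yE.
  have uyz : z x = u y by apply/eqP; rewrite eq_le zu -yE.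
  move: ls; rewrite -lws uyz -yE -base0 lower_end_base// ltxx.
  by [].
move: zu; rewrite le_eqVlt => /orP[/eqP uy|zu].
  have y1' : y < lower_end u 1.
    rewrite lt_neqAle y1 andbT; apply/eqP => yE.
    by move: z1; rewrite uy yE fuzzy_lower1// ltxx.
  have /derivable_slopeP[c uc] : derivable u y 1.
    apply: contrapT => nd; apply: noright; rewrite -lws uy.
    by apply: kink_slope => //; rewrite ly y1'.
  have c0 : 0 <= c.
    by apply: (slope_ge0_homo y1' _ uc) => t yt t1; exact: fuzzy_nondecr.
  have b1 : 0 < b.
    rewrite lt_neqAle eq_sym b0/=.
    by apply: (slope_ge0_homo s1 _ wb) => t yt t1; exact: fuzzy_nondecr.
  have bc0 : b + c != 0 by rewrite gt_eqF//; lra.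
  (* The increment [h] is shared as [k * h] for [y] and [(1 - k) * h] for [s], with [k] chosen so
     that [k * c = (1 - k) * b]. *)
  pose k := b / (b + c).
  exists (k * c); apply: (slope_between (g := fun h => u (y + k * h))
                            (k := fun h => w (s + (1 - k) * h))).
  - near=> h.
    have -> : x + h = (y + k * h) + (s + (1 - k) * h) by rewrite /x; lra.
    rewrite supmin_ge_min//= supmin_le_max//.
      by apply: ltW; near: h; apply: nbhs_dnbhs; exact: near0_affine_lt.
    by apply: ltW; near: h; apply: nbhs_dnbhs; exact: near0_affine_lt.
  - by rewrite uy; exact: slope_scale.
  - have -> : k * c = (1 - k) * b by rewrite /k; field.
    by rewrite -ws; exact: slope_scale.
(* Now [z x < u y]. The left limit [l] is at most [z x], so [u] jumps at [y]; by (v-1), equality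
   would make the right derivative of [w] at [s] vanish, hence [l < z x < u y]. *)
have [l ul ly'] := fuzzy_left_limit fu y1.
have lz : l <= z x.
  by apply: (cvgr_to_le ul); near=> t; apply: uz; near: t; exact: nbhs_left_lt.
have ncu : ~ (u @ y^'- --> u y).
  move=> cu; have := cvg_unique _ ul cu => /(_ _).
  by move=> E; move: lz; rewrite leNgt E// zu.
have {lz} lz : l < z x.
  rewrite lt_neqAle lz andbT; apply/eqP => lE; apply: noright.
  by rewrite -lws -lE; apply: jump ncu ul; rewrite ly.
have cw : w @ s --> w s.
  by apply: fuzzy_inner_cvg => //; rewrite ls (lt_le_trans s1).
have cwh : w (s + h) @[h --> 0] --> w s.
  apply: (@cvg_comp _ _ _ (fun h => s + h) w _ (nbhs s)) => //.
  by rewrite -{2}(addr0 s); apply: cvgD; [exact: cvg_cst|exact: cvg_id].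
(* For small [h] the value [w (s + h)] stays strictly between [l] and [u y], so z at [x + h] equals
   [w (s + h)] and both pinching functions are the same. *)
exists b; apply: (slope_between (g := fun h => w (s + h))
                                (k := fun h => w (s + h))); last 2 first.
- by rewrite -ws.
- by rewrite -ws.
near=> h.
have w1 : w (s + h) < u y.
  by near: h; apply: nbhs_dnbhs; apply: (cvgr_lt _ cwh); rewrite ws.
have w2 : l < w (s + h).
  by near: h; apply: nbhs_dnbhs; apply: (cvgr_gt _ cwh); rewrite ws.
have s1' : s + h < lower_end w 1.
  by near: h; apply: nbhs_dnbhs; exact: near0_shift_lt.
rewrite minxx maxxx -addrA; apply/andP; split.
  apply: le_trans (supmin_ge_min _ fu _ _).
  by rewrite le_min lexx andbT ltW.
apply: supmin_le => // [y' /ly' h1|s' ss].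
  by rewrite (le_trans h1)// ltW.
by rewrite fuzzy_nondecr// ltW.
Unshelve. all: by end_near. Qed.

Lemma supmin_derivable_left_base y s : let x := y + s in
  A < x -> x < C -> y <= lower_end u 1 ->
  s = lower_end w 0 -> z x = w s -> z x <= u y ->
  (forall y', y' < y -> u y' <= z x) ->
  derivable z x 1.
Proof.
move=> x Ax xC y1 sE zs zu uz.
have z1 : z x < 1 by apply: fuzzy_lt1; rewrite ?zC.
have a0 : z x = u (lower_end u 0) by rewrite zs sE base0.
have lws : lower_end w (z x) = s by rewrite zs sE lower_end_base.
have ly : lower_end u 0 < y by move: Ax; rewrite /x sE ltrD2r.
(* On this stretch [u] lies between its base value and [z x], which coincide here. *)
have ucst t : lower_end u 0 <= t -> t < y -> u t = z x.
  move=> lt_ ty; apply/eqP; rewrite eq_le uz//= a0.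
  by apply: fuzzy_nondecr => //; exact: le_trans (ltW ty) y1.
have s1 : s < lower_end w 1.
  rewrite lt_neqAle sE lower_end0_le// andbT; apply/eqP => E.
  by move: z1; rewrite zs sE E fuzzy_lower1// ltxx.
apply: (@derivable_onesided _ _ _ 0).
  apply: slope_cst; near=> h; apply/eqP; rewrite eq_le; apply/andP; split.
    have h0 : h < 0 by [].
    by apply: zmono; lra.
  rewrite a0; apply: supmin_base_le; last first.
    have h0 : h < 0 by [].
    lra.
  by apply: ltW; near: h; apply: cvg_within; exact: near0_shift_gt.
have right_w : is_right_derive w s 0 -> is_right_derive z x 0.
  apply: supmin_slope_pinch => //; near=> h.
  by apply: ltW; near: h; apply: cvg_within; exact: near0_shift_lt.
(* For the right derivative: if [u] jumps at [y], its left limit is [z x] and (v-1) applies; if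
   [u y = z x] without differentiability, (iv-1) applies. If [u] is differentiable at [y], flatness
   on the left makes the slope 0, and [y] is shifted with [s] fixed. *)
move: zu; rewrite le_eqVlt => /orP[/eqP uy|zu]; last first.
  apply: right_w; rewrite -lws.
  have uzx : u @ y^'- --> z x.
    apply: cvg_near_cst; near=> t.
    have ty : t < y by near: t; exact: nbhs_left_lt.
    by apply: ucst => //; near: t; exact: nbhs_left_ge.
  apply: (jump _ _ uzx); first by rewrite ly.
  by move=> cu; move: zu; rewrite (cvg_unique _ uzx cu) ?ltxx.
have y1' : y < lower_end u 1.
  rewrite lt_neqAle y1 andbT; apply/eqP => yE.
  by move: z1; rewrite uy yE fuzzy_lower1// ltxx.
have [|nd] := pselect (derivable u y 1); last first.
  by apply: right_w; rewrite -lws uy; apply: kink_slope => //; rewrite ly.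
move=> /derivable_slopeP[c uc].
have c0 : c = 0.
  apply: (slope_eq0_left_cst ly _ uc) => t lt_; rewrite le_eqVlt.
  by move=> /orP[/eqP ->//|/(ucst _ lt_) ->].
rewrite c0 in uc; apply: (slope_between_cst (g := fun h => u (y + h))).
  near=> h.
  have -> : x + h = (y + h) + s by rewrite /x; lra.
  rewrite zs [Num.min _ _]minC [Num.max _ _]maxC supmin_ge_min//=.
  rewrite supmin_le_max ?(ltW s1)//.
  by apply: ltW; near: h; apply: cvg_within; exact: near0_shift_lt.
by rewrite uy; exact: slope_right.
Unshelve. all: by end_near. Qed.

Lemma supmin_derivable_left x : A < x -> x < C -> derivable z x 1.
Proof.
move=> Ax xC; have [y [s [xE [y1 s1] [zu zw] uz wz]]] := supmin_split Ax xC.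
have z0 : 0 < z x by apply: fuzzy_gt0_inner => //; rewrite zA zC Ax ltW.
have z1 : z x < 1 by apply: fuzzy_lt1; rewrite ?zC.
have ls : lower_end w 0 <= s.
  by have /andP[] := support_bounds fw (lt_le_trans z0 zw).
rewrite {}xE in Ax xC z0 z1 zu zw uz wz *.
move: ls; rewrite le_eqVlt => /orP[/eqP ls|ls].
  apply: supmin_derivable_left_base => //.
  apply/eqP; rewrite eq_le zw -ls base0 /=.
  by rewrite ls supmin_base_le ?ltW.
(* Values of [w] left of [s] are at most z there, and left continuity of [w] inside its support
   extends this bound to [s]. *)
have ws : w s = z (y + s).
  apply/eqP; rewrite eq_le zw andbT.
  have sw : s <= upper_end w 0.
    exact: le_trans s1 (le_trans (core_ends fw) (upper_end1_le fw)).
  have : w @ s^'- --> w s by apply: fuzzy_left_cvg => //; rewrite ls.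
  move=> /cvgr_to_le; apply; near=> t; apply: wz.
  by near: t; exact: nbhs_left_lt.
apply: supmin_derivable_left_inner => //.
rewrite lt_neqAle s1 andbT; apply/eqP => sE.
by move: z1; rewrite -ws sE fuzzy_lower1// ltxx.
Unshelve. all: by end_near. Qed.

(** A zero left derivative of either function at the left end of its core is enough, the other
    coordinate being held fixed. If w^-(1) is inner, [w] has a maximum there. Otherwise w^-(1) =
    w^+(0), and [C < B] makes u^-(1) inner: either [u] is differentiable at this maximum, or (ii-1)
    applies. *)
Lemma supmin_left_derive_core : A < C -> C < B -> is_left_derive z C 0.
Proof.
move=> AC CB.
have zC1 : z C = 1 by rewrite -zC fuzzy_lower1.
have left_w : is_left_derive w (lower_end w 1) 0 -> is_left_derive z C 0.
  apply: supmin_slope_pinch; rewrite ?zC1 ?fuzzy_lower1//.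
    by move=> y _; exact: fuzzy_le1.
  by near=> h; have h0 : h < 0 by []; lra.
have left_u : is_left_derive u (lower_end u 1) 0 -> is_left_derive z C 0.
  have uC : u (lower_end u 1) = z C by rewrite zC1 fuzzy_lower1.
  rewrite /is_left_derive uC; apply: slope_between_cst; near=> h.
  have h0 : h < 0 by [].
  have -> : C + h = (lower_end u 1 + h) + lower_end w 1 by lra.
  have wC : z C = w (lower_end w 1) by rewrite zC1 fuzzy_lower1.
  rewrite wC minC maxC supmin_ge_min//=.
  by apply: supmin_le_max => //; lra.
(* A base value of 1 would make both supports start at their cores, so that [A = C]. *)
have n0 : u (lower_end u 0) <> 1.
  move=> u01; have w01 : w (lower_end w 0) = 1 by rewrite base0.
  have := lower_end_base fu; have := lower_end_base fw; rewrite u01 w01.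
  by move=> E1 E2; move: AC; rewrite E1 E2 ltxx.
have lu : lower_end u 0 < lower_end u 1.
  rewrite lt_neqAle lower_end0_le// andbT; apply/eqP => E.
  by apply: n0; rewrite E fuzzy_lower1.
have lw : lower_end w 0 < lower_end w 1.
  rewrite lt_neqAle lower_end0_le// andbT; apply/eqP => E.
  by apply: n0; rewrite -base0 E fuzzy_lower1.
have wsu : lower_end w 1 <= upper_end w 0.
  exact: le_trans (core_ends fw) (upper_end1_le fw).
have usu : lower_end u 1 <= upper_end u 0.
  exact: le_trans (core_ends fu) (upper_end1_le fu).
move: wsu; rewrite le_eqVlt => /orP[/eqP wE|wlt]; last first.
  apply: left_w; apply: slope_left; apply: derive_at_max.
    by apply: hw.2; rewrite lw.
  by move=> t; rewrite fuzzy_lower1// fuzzy_le1.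
move: usu; rewrite le_eqVlt => /orP[/eqP uE|ult].
  by move: CB; rewrite wE uE ltxx.
have [du|ndu] := pselect (derivable u (lower_end u 1) 1).
  apply: left_u; apply: slope_left; apply: derive_at_max => //.
  by move=> t; rewrite fuzzy_lower1// fuzzy_le1.
by apply: left_w; apply: kink_core => //; rewrite lu.
Unshelve. all: by end_near. Qed.

(** When [w] has a nondegenerate support, z at [A + h] is squeezed between the minimum and the
    maximum of the base value and [w] at w^-(0) + h, and both tend to the base value. *)
Lemma supmin_right_cvg_base : A < B -> z @ A^'+ --> z A.
Proof.
move=> AB; rewrite supmin_base.
have := lower_le_upper fw i01; rewrite le_eqVlt => /orP[/eqP wE|wlt].
  (* [w] is crisp at a point, so [u] and the convolution are indicator
     functions of intervals. *)
  have w1 : w (lower_end w 0) = 1.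
    rewrite -(fuzzy_lower1 fw); congr w; apply/eqP.
    rewrite eq_le lower_end0_le//= wE.
    exact: le_trans (core_ends fw) (upper_end1_le fw).
  apply: cvg_near_cst; near=> t.
  have tA : A < t by near: t; exact: nbhs_right_gt.
  have tB : t < B by near: t; exact: nbhs_right_lt.
  apply/eqP; rewrite eq_le -base0 w1 fuzzy_le1//=.
  (* Both [A] and [B] lie in the level 1 of z, the latter by the second half of (i), and that level
     is an interval. *)
  have h1 (x : R) : 1 <= z x -> lower_end z 1 <= x <= upper_end z 1.
    by rewrite level_setP ?ltr01 ?lexx.
  have /h1/andP[lA _] : 1 <= z A by rewrite supmin_base -base0 w1.
  have /h1/andP[_ lB] : 1 <= z B.
    apply: le_trans (supmin_ge_min _ fu _ _).
    by rewrite -base1 -wE w1 minxx.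
  rewrite level_setP ?ltr01 ?lexx//.
  by rewrite (le_trans lA (ltW tA)) (le_trans (ltW tB) lB).
have [wc _] := fuzzy_ends_cvg hw wlt.
move: wc; rewrite base0 => /cvg_right_shiftP wc; apply/cvg_right_shiftP.
have below : \forall h \near 0^'+,
    z (A + h) <= Num.max (u (lower_end u 0)) (w (lower_end w 0 + h)).
  have := lower_end0_le fw i11; rewrite le_eqVlt => /orP[/eqP E|lw1].
    have w1 : w (lower_end w 0) = 1 by rewrite E fuzzy_lower1.
    by apply: nearW => h; rewrite -base0 w1 le_max fuzzy_le1.
  near=> h.
  have h1 : lower_end w 0 + h < lower_end w 1.
    by near: h; apply: cvg_within; exact: near0_shift_lt.
  rewrite -addrA; apply: supmin_le => // [y /(fuzzy_eq0_below fu) ->|s sh].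
    by rewrite le_max fuzzy_ge0.
  by rewrite le_max [X in _ || X]fuzzy_nondecr ?orbT// ltW.
have max_cvg : Num.max (u (lower_end u 0)) (w (lower_end w 0 + h))
    @[h --> 0^'+] --> u (lower_end u 0).
  apply/cvgrPdist_lt => e e0; move/cvgrPdist_lt : wc => /(_ _ e0).
  by apply: filterS => h; case: (leP (u _)) => // _ _; rewrite subrr normr0.
have min_cvg : Num.min (u (lower_end u 0)) (w (lower_end w 0 + h))
    @[h --> 0^'+] --> u (lower_end u 0).
  apply/cvgrPdist_lt => e e0; move/cvgrPdist_lt : wc => /(_ _ e0).
  by apply: filterS => h; case: (leP (u _)) => // _ _; rewrite subrr normr0.
apply: squeeze_cvgr min_cvg max_cvg.
by apply: filterS below => h ->; rewrite andbT -addrA supmin_ge_min.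
Unshelve. all: by end_near. Qed.

End LeftBranch.

(** * Both branches *)

Lemma fuzzy_differentiable_intro (R : realType) (v : R -> R) :
  fuzzy_number v ->
  (forall x, lower_end v 0 < x < upper_end v 0 -> derivable v x 1) ->
  (lower_end v 0 < upper_end v 0 ->
     v @ (lower_end v 0)^'+ --> v (lower_end v 0) /\
     v @ (upper_end v 0)^'- --> v (upper_end v 0)) ->
  fuzzy_differentiable v.
Proof.
move=> fv dv cv; split=> //; split=> //.
have i01 : 0 <= (0 : R) <= 1 by rewrite lexx ler01.
rewrite level_setE//; have := lower_le_upper fv i01.
rewrite le_eqVlt => /orP[/eqP E|lu].
  by rewrite E set_itv1; exact: continuous_subspace1.
have [cl cr] := cv lu; apply/(continuous_within_itvP _ lu); split=> // x.
by rewrite in_itv/= => /dv/derivable1_diffP/differentiable_continuous.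
Qed.

Lemma fuzzy_differentiable_opp (R : realType) (v : R -> R) :
  fuzzy_differentiable v -> fuzzy_differentiable (v \o -%R).
Proof.
move=> hv; have [[fv _] dv] := hv.
apply: fuzzy_differentiable_intro; first exact: fuzzy_number_opp.
  move=> x; rewrite lower_end_opp upper_end_opp => /andP[lx xu].
  by apply/derivable_comp_opp; apply: dv; rewrite ltrNr xu ltrNl lx.
rewrite lower_end_opp upper_end_opp ltrN2 => lu.
have [cl cr] := fuzzy_ends_cvg hv lu.
by split; [apply/cvg_opp_at_right|apply/cvg_opp_at_left]; rewrite /= opprK.
Qed.

Theorem theorem5p21 (R : realType) (u w : R -> R)
  (hu : fuzzy_number u) (hw : fuzzy_differentiable w)
  (h_i : w (lower_end w 0) = u (lower_end u 0) /\
         w (upper_end w 0) = u (upper_end u 0))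
  (h_ii1 : lower_end u 0 < lower_end u 1 < upper_end u 0 ->
     ~ derivable u (lower_end u 1) 1 ->
     is_left_derive w (lower_end w 1) 0)
  (h_ii2 : lower_end u 0 < upper_end u 1 < upper_end u 0 ->
     ~ derivable u (upper_end u 1) 1 ->
     is_right_derive w (upper_end w 1) 0)
  (h_iv : forall x : R, lower_end u 0 < x < upper_end u 0 ->
     ~ derivable u x 1 ->
     (lower_end u 0 < x < lower_end u 1 ->
        is_right_derive w (lower_end w (u x)) 0) /\
     (upper_end u 1 < x < upper_end u 0 ->
        is_left_derive w (upper_end w (u x)) 0))
  (h_v1 : forall x b : R, lower_end u 0 < x <= lower_end u 1 ->
     ~ (u @ x^'- --> u x) ->
     u @ x^'- --> b ->
     is_right_derive w (lower_end w b) 0)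
  (h_v2 : forall x c : R, upper_end u 1 <= x < upper_end u 0 ->
     ~ (u @ x^'+ --> u x) ->
     u @ x^'+ --> c ->
     is_left_derive w (upper_end w c) 0) :
  smoother w u.
Proof.
have [b0 b1] := h_i; have [[fw _] _] := hw.
have i01 : 0 <= (0 : R) <= 1 by rewrite lexx ler01.
have i11 : 0 <= (1 : R) <= 1 by rewrite lexx ler01.
(* The reflected pair satisfies the assumptions of the left branch: (ii-2), (iv-2) and (v-2) turn
   into (ii-1), (iv-1) and (v-1). *)
pose u' := u \o -%R; pose w' := w \o -%R.
have fu' : fuzzy_number u' by exact: fuzzy_number_opp.
have hw' : fuzzy_differentiable w' by exact: fuzzy_differentiable_opp.
have b0' : w' (lower_end w' 0) = u' (lower_end u' 0).
  by rewrite !lower_end_opp /u' /w' /= !opprK.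
have b1' : w' (upper_end w' 0) = u' (upper_end u' 0).
  by rewrite !upper_end_opp /u' /w' /= !opprK.
have lu1 : lower_end u 1 <= upper_end u 0.
  exact: le_trans (core_ends hu) (upper_end1_le hu).
have lu1' : lower_end u 0 <= upper_end u 1.
  exact: le_trans (lower_end0_le hu i11) (core_ends hu).
have kc : lower_end u' 0 < lower_end u' 1 < upper_end u' 0 ->
    ~ derivable u' (lower_end u' 1) 1 -> is_left_derive w' (lower_end w' 1) 0.
  rewrite !lower_end_opp upper_end_opp !ltrN2 andbC => h nd.
  apply/left_derive_comp_opp; rewrite opprK oppr0.
  apply: h_ii2 => // du; apply: nd.
  by apply/derivable_comp_opp; rewrite opprK.
have ks x : lower_end u 0 < x < lower_end u 1 ->
    ~ derivable u x 1 -> is_right_derive w (lower_end w (u x)) 0.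
  move=> xl nd; apply: (h_iv x _ nd).1 => //.
  by case/andP: xl => -> /= /lt_le_trans; apply.
have ks' x : lower_end u' 0 < x < lower_end u' 1 ->
    ~ derivable u' x 1 -> is_right_derive w' (lower_end w' (u' x)) 0.
  rewrite !lower_end_opp => xl nd.
  apply/right_derive_comp_opp; rewrite opprK oppr0.
  move/andP: xl; rewrite ltrNl ltrNr => -[xu x1].
  apply: (h_iv (- x) _ _).2 => [|du|]; last by rewrite xu x1.
    by rewrite xu (le_lt_trans lu1' x1).
  by apply: nd; apply/derivable_comp_opp.
have jp' x b : lower_end u' 0 < x <= lower_end u' 1 ->
    ~ (u' @ x^'- --> u' x) -> u' @ x^'- --> b ->
    is_right_derive w' (lower_end w' b) 0.
  rewrite !lower_end_opp => xl nc /cvg_opp_at_left ub.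
  apply/right_derive_comp_opp; rewrite opprK oppr0.
  move/andP: xl; rewrite ltrNl lerNr => -[xu x1].
  apply: (h_v2 (- x)) ub; first by rewrite xu x1.
  by move=> cu; apply: nc; apply/cvg_opp_at_left.
have fz : fuzzy_number (supmin_conv u w) by exact: supmin_fuzzy.
have left_part := supmin_derivable_left hu hw b0 ks h_v1.
have left_core := supmin_left_derive_core hu hw b0 h_ii1.
have left_base := supmin_right_cvg_base hu hw b0 b1.
have right_part x : upper_end u 1 + upper_end w 1 < x ->
    x < upper_end u 0 + upper_end w 0 -> derivable (supmin_conv u w) x 1.
  move=> x1 x2; rewrite -(opprK x); apply/derivable_comp_opp.
  rewrite -supmin_opp; apply: (supmin_derivable_left fu' hw' b0' ks' jp');
  rewrite !lower_end_opp; lra.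
have right_core :
    lower_end u 0 + lower_end w 0 < upper_end u 1 + upper_end w 1 ->
    upper_end u 1 + upper_end w 1 < upper_end u 0 + upper_end w 0 ->
    is_right_derive (supmin_conv u w) (upper_end u 1 + upper_end w 1) 0.
  move=> x1 x2; rewrite -(opprK (_ + upper_end w 1)).
  rewrite -[X in is_right_derive _ _ X]oppr0.
  apply/left_derive_comp_opp; rewrite -supmin_opp opprD -!lower_end_opp.
  apply: (supmin_left_derive_core fu' hw' b0' kc);
  rewrite ?upper_end_opp !lower_end_opp; lra.
have right_base :
    lower_end u 0 + lower_end w 0 < upper_end u 0 + upper_end w 0 ->
    supmin_conv u w @ (upper_end u 0 + upper_end w 0)^'- -->
    supmin_conv u w (upper_end u 0 + upper_end w 0).
  move=> AB; have := supmin_right_cvg_base fu' hw' b0' b1'.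
  rewrite !lower_end_opp !upper_end_opp -(opprD (upper_end u 0)).
  rewrite -(opprD (lower_end u 0)) ltrN2 => /(_ AB).
  by rewrite supmin_opp => /cvg_opp_at_right; rewrite /= opprK.
apply: fuzzy_differentiable_intro;
  rewrite ?lower_end_supmin ?upper_end_supmin//.
  move=> x /andP[Ax xB].
  have [xC|Cx] := ltP x (lower_end u 1 + lower_end w 1); first exact: left_part.
  have [Dx|xD] := ltP (upper_end u 1 + upper_end w 1) x.
    exact: right_part.
  (* What remains is the core of z, where z is 1: one-sided quotients pointing into the core vanish,
     and those pointing out of it at its ends come from [left_core] and [right_core]. *)
  have core t : lower_end u 1 + lower_end w 1 <= t ->
      t <= upper_end u 1 + upper_end w 1 -> supmin_conv u w t = 1.
    move=> Ct tD; apply: (fuzzy_core fz).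
    by rewrite lower_end_supmin// upper_end_supmin// Ct.
  apply: (@derivable_onesided _ _ _ 0).
    move: Cx; rewrite le_eqVlt => /orP[/eqP xE|Cx].
      by rewrite -xE in Ax xB *; exact: left_core.
    apply: slope_cst; near=> h; rewrite !core ?(ltW Cx)//.
      by apply: ltW; near: h; apply: cvg_within; exact: near0_shift_gt.
    have h0 : h < 0 by []; lra.
  move: xD; rewrite le_eqVlt => /orP[/eqP xE|xD].
    by rewrite xE in Ax xB *; exact: right_core.
  apply: slope_cst; near=> h; rewrite !core ?(ltW xD)//.
    have h0 : 0 < h by []; lra.
  by apply: ltW; near: h; apply: cvg_within; exact: near0_shift_lt.
by move=> AB; split; [exact: left_base|exact: right_base].
Unshelve. all: by end_near. Qed.
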